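(* For every $n\in\mathbb{N}$, $$U(2n)=\left\{\frac12\begin{bmatrix} A & 0 \\ 0 & B \end{bmatrix}\begin{bmatrix} I+Z & I-Z \\ {} I-Z & I+Z \end{bmatrix}\begin{bmatrix} I & 0 \\ 0 & C \end{bmatrix}:\ A,B,C,Z\in U(n)\right\},$$ where $I$ is the identity matrix in $U(n)$ and all matrices on the right are $2n\times2n$ matrices written in $n\times n$ blocks.
   Context: $U(n)$ denotes the group of complex $n\times n$ unitary matrices. *)

(* Defs.v *)
From mathcomp Require Import all_boot all_order all_algebra.
From mathcomp Require Import complex.
From mathcomp Require Import boolp classical_sets reals.

Set Implicit Arguments.
Unset Strict Implicit.
Unset Printing Implicit Defensive.

Import GRing.Theory.
Local Open Scope ring_scope.
Local Open Scope complex_scope.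
Local Open Scope classical_set_scope.

(* [R[i]] is the field of complex numbers over the reals [R]; [unitarymx] says
   [M *m M^t* = 1%:M], with [M^t*] the conjugate transpose. *)
Definition U (R : realType) (n : nat) : set 'M[R[i]]_n :=
  [set M | M \is unitarymx].
Arguments U : clear implicits.

(* Main.v *)
(* Write a unitary matrix in blocks as [P Q; R S].  Up to multiplying the second
   block column by a unitary V, the blocks can be read off: A = P + QV,
   B = R + SV, C = V^*, Z = A^* (P - QV), and these are all unitary exactly when
   V^* Q^* Q V = 1 - P^* P and P^* Q V is skew-Hermitian.  If P = W s F is a
   singular value decomposition, then P P^* + Q Q^* = 1 gives Q = W t Y with
   s^2 + t^2 = 1, so that V = i Y^* F works: P^* Q V = i F^* s t F. *)
Require Import Defs.
From mathcomp Require Import all_boot all_order all_algebra.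
From mathcomp Require Import complex.
From mathcomp Require Import boolp classical_sets reals.
From mathcomp Require Import ring.

Set Implicit Arguments.
Unset Strict Implicit.
Unset Printing Implicit Defensive.

Import GRing.Theory.
Local Open Scope ring_scope.
Local Open Scope complex_scope.
Local Open Scope classical_set_scope.

Import Num.Theory.
Local Open Scope sesquilinear_scope.

(** * Conjugate transposes and unitary block matrices *)

Lemma trmxC_mul (C : numClosedFieldType) (m n p : nat)
    (A : 'M[C]_(m, n)) (B : 'M[C]_(n, p)) : (A *m B)^t* = B^t* *m A^t*.
Proof. by rewrite trmx_mul map_mxM. Qed.

Lemma trmxCD (C : numClosedFieldType) (m n : nat) (A B : 'M[C]_(m, n)) :
  (A + B)^t* = A^t* + B^t*.
Proof. by rewrite linearD/= map_mxD. Qed.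

Lemma trmxCN (C : numClosedFieldType) (m n : nat) (A : 'M[C]_(m, n)) :
  (- A)^t* = - A^t*.
Proof. by rewrite linearN/= map_mxN. Qed.

Lemma trmxCZ (C : numClosedFieldType) (m n : nat) (a : C) (A : 'M[C]_(m, n)) :
  (a *: A)^t* = Num.conj a *: A^t*.
Proof. by rewrite linearZ/= map_mxZ. Qed.

Lemma trmxC1 (C : numClosedFieldType) (n : nat) : (1%:M : 'M[C]_n)^t* = 1%:M.
Proof. by rewrite trmx1 map_mx1. Qed.

Lemma trmxC_block (C : numClosedFieldType) (m1 m2 n1 n2 : nat)
    (P : 'M[C]_(m1, n1)) (Q : 'M_(m1, n2)) (R : 'M_(m2, n1)) (S : 'M_(m2, n2)) :
  (block_mx P Q R S)^t* = block_mx (P^t*) (R^t*) (Q^t*) (S^t*).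
Proof. by rewrite tr_block_mx map_block_mx. Qed.

Lemma trmxC_diag_ge0 (C : numClosedFieldType) (n : nat) (d : 'rV[C]_n) :
  (forall i, 0 <= d 0 i) -> (diag_mx d)^t* = diag_mx d.
Proof.
move=> d0; rewrite tr_diag_mx map_diag_mx; congr diag_mx.
by apply/rowP => i; rewrite mxE; apply/CrealP/ger0_real.
Qed.

Lemma unitarymxPl (C : numClosedFieldType) (n : nat) (A : 'M[C]_n) :
  reflect (A^t* *m A = 1%:M) (A \is unitarymx).
Proof. by apply: (iffP unitarymxP) => /mulmx1C. Qed.

Lemma unitarymx_block_diag (C : numClosedFieldType) (n : nat) (A B : 'M[C]_n) :
  A \is unitarymx -> B \is unitarymx -> block_mx A 0 0 B \is unitarymx.
Proof.
move=> /unitarymxP uA /unitarymxP uB; apply/unitarymxP.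
rewrite trmxC_block !trmx0 !map_mx0 mulmx_block uA uB.
by rewrite !(mulmx0, mul0mx, addr0, add0r) -scalar_mx_block.
Qed.

(** In the product with the conjugate transpose, the terms linear in [Z] and [Z^t*] cancel in every
    block. This leaves [2 + 2 Z Z^*] on the diagonal and [2 - 2 Z Z^*] off it, that is, 4 and 0. *)
Lemma unitarymx_block_half (C : numClosedFieldType) (n : nat) (Z : 'M[C]_n) :
  Z \is unitarymx ->
  2^-1 *: block_mx (1%:M + Z) (1%:M - Z) (1%:M - Z) (1%:M + Z) \is unitarymx.
Proof.
move=> /unitarymxP uZ; apply/unitarymxP.
have nz2 : (2 : C) != 0 by rewrite pnatr_eq0.
rewrite trmxCZ -scalemxAl -scalemxAr scalerA trmxC_block mulmx_block.
rewrite !trmxCD trmxCN trmxC1.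
rewrite !(mulmxDl, mulmxDr, mulmxN, mulNmx, mul1mx, mulmx1, uZ, opprK).
have -> : Num.conj (2^-1 : C) = 2^-1 by apply/CrealP; rewrite realV realn.
rewrite (scalar_mx_block n n 1) scale_block_mx.
by congr block_mx; apply/matrixP => i j; rewrite !mxE; field.
Qed.

(** The hypotheses are the square terms and the cross terms of [(X + Y)^t* *m (X + Y)]. *)
Lemma unitarymx_addr (C : numClosedFieldType) (n : nat) (X Y : 'M[C]_n) :
  X^t* *m X + Y^t* *m Y = 1%:M -> X^t* *m Y + Y^t* *m X = 0 ->
  X + Y \is unitarymx.
Proof.
move=> h1 h2; apply/unitarymxPl.
by rewrite trmxCD mulmxDl !mulmxDr [Y^t* *m X + _]addrC addrACA h1 h2 addr0.
Qed.

(* A vanishing [d i] forces the [i]-th row to vanish; replacing it by a unit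
   vector orthogonal to all rows decreases the number of zeros of [d]. *)
Lemma orthogonal_rows_scaled_unitary (C : numClosedFieldType) (n : nat)
    (M : 'M[C]_n) (d : 'I_n -> C) :
  (forall i j, dotmx (row i M) (row j M) = (`|d i| ^+ 2) *+ (i == j)) ->
  exists2 Y : 'M[C]_n, Y \is unitarymx & forall i, row i M = d i *: row i Y.
Proof.
have [k] := ubnP #|[pred i | d i == 0]|; elim: k => // k IH in M d * => ltk H.
have [i0 /eqP di0|nz] := pickP [pred i | d i == 0]; last first.
  have {}nz i : d i != 0 by apply/negbT/nz.
  exists (\matrix_i ((d i)^-1 *: row i M)); last first.
    by move=> i; rewrite rowK scalerA mulfV ?scale1r.
  apply/row_unitarymxP => i j; rewrite !rowK linearZl_LR linearZr_LR/= H.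
  case: eqP => [<-|_]; last by rewrite !mulr0.
  rewrite normCK mulr1n fmorphV/=; field.
  by rewrite conjC_eq0 nz.
have M0 : row i0 M = 0.
  have /eqP := H i0 i0.
  by rewrite di0 normr0 expr0n mul0rn (dnorm_eq0 (@dotmx C n)) => /eqP.
(* A zero row makes [M] singular, so [M^t*] has a nonzero left kernel vector; normalized, it is a
   unit vector orthogonal to every row of [M]. *)
have [u u1 uM] : exists2 u : 'rV[C]_n, dotmx u u = 1 & u *m M^t* = 0.
  have /det0P[v v0 vM] : \det (M^t*) == 0.
    rewrite det_map_mx det_tr conjC_eq0; apply/det0P.
    exists (delta_mx 0 i0); last by rewrite -rowE.
    by apply/eqP => /rowP/(_ i0)/eqP; rewrite !mxE !eqxx oner_eq0.
  exists ((sqrtC (dotmx v v))^-1 *: v); last by rewrite -scalemxAl vM scaler0.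
  rewrite (dnormZ (@dotmx C n)) normfV ger0_norm ?sqrtC_ge0 ?dnorm_ge0//.
  by rewrite exprVn sqrtCK mulVf// dnorm_eq0.
have uM' i : dotmx u (row i M) = 0.
  have /rowP/(_ i) := uM; rewrite mxE [RHS]mxE => h.
  by rewrite dotmxE mxE -[RHS]h; apply: eq_bigr => j _; rewrite !mxE.
have Mu i : dotmx (row i M) u = 0.
  by rewrite (hermC (@dotmx C n)) (_ : _ u _ = 0) ?rmorph0 ?mulr0//; exact: uM'.
have [] := IH (\matrix_i (if i == i0 then u else row i M)) (fun i => if i == i0 then 1 else d i).
- rewrite ltnS in ltk; apply: leq_trans ltk; apply: proper_card; apply/properP; split.
    by apply/fintype.subsetP => i; rewrite !inE; case: ifP => //; rewrite oner_eq0.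
  by exists i0; rewrite !inE ?di0// eqxx oner_eq0.
- move=> i j; rewrite !rowK; case: (eqVneq i i0) => [->|ni].
    by case: (eqVneq j i0) => [_|nj]; rewrite ?u1 ?normr1 ?expr1n ?uM'.
  case: (eqVneq j i0) => [->|nj]; last by rewrite H.
  by rewrite Mu (negPf ni).
move=> Y uY HY; exists Y => // i; have := HY i; rewrite rowK.
by case: eqP => [->|//]; rewrite M0 di0 scale0r.
Qed.

(** * Factorizations obtained from diagonal Gram matrices *)

Lemma diag_gram_ge0 (C : numClosedFieldType) (n : nat) (M : 'M[C]_n)
    (d : 'rV[C]_n) : M *m M^t* = diag_mx d -> forall i, 0 <= d 0 i.
Proof.
move=> /matrixP H i; have := H i i; rewrite !mxE eqxx mulr1n => <-.
by apply: sumr_ge0 => j _; rewrite !mxE mul_conjC_ge0.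
Qed.

(** A diagonal Gram matrix means pairwise orthogonal rows with squared norms [d 0 i], so the rows
    are those of a unitary matrix scaled by the square roots. *)
Lemma diag_gram_factor (C : numClosedFieldType) (n : nat) (M : 'M[C]_n)
    (d : 'rV[C]_n) : M *m M^t* = diag_mx d ->
  exists2 Y, Y \is unitarymx & M = diag_mx (map_mx sqrtC d) *m Y.
Proof.
move=> H; have d0 := diag_gram_ge0 H.
have [|Y uY HY] := @orthogonal_rows_scaled_unitary C n M (fun i => sqrtC (d 0 i)).
  move=> i j; rewrite ger0_norm ?sqrtC_ge0// sqrtCK.
  have /matrixP/(_ i j) := H; rewrite dotmxE !mxE => <-.
  by apply: eq_bigr => k _; rewrite !mxE.
exists Y => //; apply/row_matrixP => i.
by rewrite HY row_mul row_diag_mx -scalemxAl -rowE mxE.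
Qed.

(** Diagonalize [P^t* *m P] as [F^t* *m diag_mx d *m F]. Then [F *m P^t*] has Gram matrix
    [diag_mx d], hence equals [diag_mx s *m Y], and taking conjugate transposes gives [P] with
    [W = Y^t*]. *)
Lemma svd (C : numClosedFieldType) (n : nat) (P : 'M[C]_n) :
  exists (W F : 'M[C]_n) (s : 'rV_n), [/\ W \is unitarymx, F \is unitarymx,
    forall i, 0 <= s 0 i & P = W *m diag_mx s *m F].
Proof.
have : P^t* *m P \is normalmx by apply/normalmxP; rewrite trmxC_mul trmxCK.
move=> /orthomx_spectralP; set F := spectralmx _; set d := spectral_diag _.
have uF : F \is unitarymx by exact: spectral_unitarymx.
rewrite invmx_unitary// => PP.
have H : (F *m P^t*) *m (F *m P^t*)^t* = diag_mx d.
  rewrite trmxC_mul trmxCK mulmxA -(mulmxA F) PP !mulmxA (unitarymxP uF) mul1mx.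
  by rewrite -mulmxA (unitarymxP uF) mulmx1.
have s0 i : 0 <= (map_mx sqrtC d) 0 i by rewrite mxE sqrtC_ge0 (diag_gram_ge0 H).
have [Y uY HY] := diag_gram_factor H.
exists (Y^t*), F, (map_mx sqrtC d); split => //; first by rewrite trmxC_unitary.
rewrite -(trmxC_diag_ge0 s0) -trmxC_mul -HY trmxC_mul trmxCK -mulmxA.
by rewrite (unitarymxPl _ uF) mulmx1.
Qed.

(** Since [Q *m Q^t*] is [1 - P *m P^t*], the left factor [W] of [P] diagonalizes it too; so
    [W^t* *m Q] has a diagonal Gram matrix and splits as [diag_mx t *m Y]. *)
Lemma block_row_cs (C : numClosedFieldType) (n : nat) (P Q : 'M[C]_n) :
  P *m P^t* + Q *m Q^t* = 1%:M ->
  exists (W F Y : 'M[C]_n) (s t : 'rV_n), [/\ W \is unitarymx, F \is unitarymx, Y \is unitarymx,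
    [/\ forall i, 0 <= s 0 i, forall i, 0 <= t 0 i &
    diag_mx s *m diag_mx s + diag_mx t *m diag_mx t = 1%:M] &
    P = W *m diag_mx s *m F /\ Q = W *m diag_mx t *m Y].
Proof.
have [W [F [s [uW uF s0 ->]]]] := svd P.
rewrite !trmxC_mul (trmxC_diag_ge0 s0) !mulmxA (mulmxtVK _ uF) => H.
pose d : 'rV[C]_n := \row_i (1 - s 0 i ^+ 2).
have ds : diag_mx d = 1%:M - diag_mx s *m diag_mx s.
  apply/matrixP => i j; rewrite mulmx_diag !mxE.
  by case: eqP => _; rewrite ?mulr1n ?mulr0n ?subr0// expr2.
have HQ : (W^t* *m Q) *m (W^t* *m Q)^t* = diag_mx d.
  rewrite ds trmxC_mul trmxCK -mulmxA (mulmxA Q).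
  have -> : Q *m Q^t* = 1%:M - W *m diag_mx s *m diag_mx s *m W^t*.
    by rewrite -H addrC addKr.
  rewrite mulmxBl mul1mx mulmxBr (unitarymxPl _ uW) !mulmxA (unitarymxPl _ uW).
  by rewrite mul1mx -mulmxA (unitarymxPl _ uW) mulmx1.
(* The bound [s 0 i <= 1] comes for free: [1 - s 0 i ^+ 2] is a diagonal entry of a Gram matrix. *)
have t0 i : 0 <= (map_mx sqrtC d) 0 i by rewrite mxE sqrtC_ge0 (diag_gram_ge0 HQ).
have [Y uY HY] := diag_gram_factor HQ.
exists W, F, Y, s, (map_mx sqrtC d); split => //.
  split => //; rewrite -[RHS](subrK (diag_mx s *m diag_mx s)) -ds addrC.
  congr (_ + _); rewrite mulmx_diag; congr diag_mx.
  by apply/rowP => i; rewrite !mxE -expr2 sqrtCK.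
by split=> //; rewrite -mulmxA -HY mulmxA (unitarymxP uW) mul1mx.
Qed.

(** * The block factorization and its converse *)

Lemma unitary_block_factor (C : numClosedFieldType) (n : nat)
    (M : 'M[C]_(n + n)) : M \is unitarymx ->
  exists A B D Z : 'M[C]_n, [/\ A \is unitarymx, B \is unitarymx,
    D \is unitarymx, Z \is unitarymx &
    M = 2^-1 *: (block_mx A 0 0 B
                 *m block_mx (1%:M + Z) (1%:M - Z) (1%:M - Z) (1%:M + Z)
                 *m block_mx 1%:M 0 0 D)].
Proof.
move=> uM; rewrite -[M]submxK in uM *.
move: (ulsubmx M) (ursubmx M) (dlsubmx M) (drsubmx M) uM => P Q R S uM.
have PQ : P *m P^t* + Q *m Q^t* = 1%:M.
  have /unitarymxP := uM; rewrite trmxC_block mulmx_block (scalar_mx_block n n 1).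
  by case/eq_block_mx.
have [W [F [Y [s [t [uW uF uY [s0 t0 st] [eP eQ]]]]]]] := block_row_cs PQ.
pose V := 'i *: (Y^t* *m F).
have uV : V \is unitarymx.
  apply/unitarymxP; rewrite /V trmxCZ -scalemxAl -scalemxAr scalerA.
  rewrite conjCi mulrN -expr2 sqrCi opprK scale1r.
  by apply/unitarymxP/mul_unitarymx; rewrite ?trmxC_unitary.
have : block_mx P Q R S *m block_mx 1%:M 0 0 V \is unitarymx.
  by rewrite mul_unitarymx// unitarymx_block_diag//; apply/unitarymxP; rewrite trmxC1 mulmx1.
rewrite mulmx_block !(mulmx1, mulmx0, addr0, add0r).
(* From here on [Q'] and [S'] stand for [Q *m V] and [S *m V]; the original blocks survive only as
   [Q' *m V^t*] and [S' *m V^t*]. *)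
have : Q *m V *m V^t* = Q by rewrite mulmxtVK.
have : S *m V *m V^t* = S by rewrite mulmxtVK.
have : Q *m V = 'i *: (W *m diag_mx t *m F).
  by rewrite eQ /V -scalemxAr mulmxA mulmxtVK.
move: (Q *m V) (S *m V) => Q' S' eQ' <- <- {PQ eQ uM} /unitarymxPl.
rewrite trmxC_block mulmx_block (scalar_mx_block n n 1).
case/eq_block_mx => PR PQRS _ QS.
have WW X : W^t* *m (W *m X) = X by rewrite mulmxA (unitarymxPl _ uW) mul1mx.
have PPE : P^t* *m P = F^t* *m (diag_mx s *m diag_mx s) *m F.
  by rewrite eP !trmxC_mul (trmxC_diag_ge0 s0) -!mulmxA WW.
have QQE : Q'^t* *m Q' = F^t* *m (diag_mx t *m diag_mx t) *m F.
  rewrite eQ' trmxCZ !trmxC_mul (trmxC_diag_ge0 t0).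
  rewrite -scalemxAl -scalemxAr scalerA conjCi mulNr -expr2 sqrCi opprK scale1r.
  by rewrite -!mulmxA WW.
(* The two summands are [i F^* s t F] and [-i F^* t s F]; diagonal matrices commute. *)
have PQE : P^t* *m Q' + Q'^t* *m P = 0.
  rewrite eQ' eP trmxCZ !trmxC_mul (trmxC_diag_ge0 s0) (trmxC_diag_ge0 t0).
  rewrite -scalemxAl -scalemxAr conjCi scaleNr -!mulmxA !WW.
  by rewrite (mulmxA (diag_mx s)) diag_mxC -mulmxA subrr.
have PQ1 : P^t* *m P + Q'^t* *m Q' = 1%:M.
  rewrite PPE QQE -mulmxDl -mulmxDr st mulmx1; exact/unitarymxPl.
(* Orthonormality of the block columns carries the relations of the upper row over to the lower one,
   with [R] in the role of [Q'], [S'] in that of [P], and the mixed products negated. *)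
have RRE : R^t* *m R = Q'^t* *m Q'.
  by apply: (addrI (P^t* *m P)); rewrite PR PQ1.
have SSE : S'^t* *m S' = P^t* *m P.
  by apply: (addrI (Q'^t* *m Q')); rewrite QS addrC PQ1.
have RSE : R^t* *m S' = - (P^t* *m Q').
  by apply/eqP; rewrite -addr_eq0 addrC PQRS.
have SRE : S'^t* *m R = - (Q'^t* *m P).
  by rewrite -[R]trmxCK -trmxC_mul RSE trmxCN trmxC_mul trmxCK.
have RS1 : R^t* *m R + S'^t* *m S' = 1%:M by rewrite RRE SSE addrC.
have RSskew : R^t* *m S' + S'^t* *m R = 0 by rewrite RSE SRE -opprD PQE oppr0.
have uA : P + Q' \is unitarymx by exact: unitarymx_addr.
have uB : R + S' \is unitarymx by exact: unitarymx_addr.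
have uA' : P - Q' \is unitarymx.
  apply: unitarymx_addr; rewrite trmxCN !(mulmxN, mulNmx) ?opprK//.
  by rewrite -opprD PQE oppr0.
pose Z := (P + Q')^t* *m (P - Q').
have AZ : (P + Q') *m Z = P - Q' by rewrite mulmxA (unitarymxP uA) mul1mx.
(* The same [Z] must serve both block rows: expanding either product gives the same four terms by
   the relations just found. *)
have ZE : Z = (R + S')^t* *m (S' - R).
  rewrite /Z !trmxCD !(mulmxDl, mulmxDr, mulmxN) RSE SRE RRE SSE.
  by apply/matrixP => i j; rewrite !mxE; ring.
have BZ : (R + S') *m Z = S' - R by rewrite ZE mulmxA (unitarymxP uB) mul1mx.
exists (P + Q'), (R + S'), (V^t*), Z; split => //.
- by rewrite trmxC_unitary.
- by rewrite mul_unitarymx// trmxC_unitary.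
(* With [A = P + Q'] and [B = R + S'], the sums [A + AZ], [A - AZ], [B - BZ], [B + BZ] are twice
   [P], [Q'], [R], [S']. *)
rewrite !mulmx_block !(mul0mx, mulmx0, mulmx1, addr0, add0r).
rewrite !(mulmxDr, mulmxN, mulmx1) AZ BZ.
have nz2 : (2 : C) != 0 by rewrite pnatr_eq0.
have half X : 2^-1 *: (X + X) = X :> 'M[C]_n.
  by rewrite -mulr2n -scaler_nat scalerA mulVf// scale1r.
rewrite scale_block_mx !scalemxAl.
have -> : P + Q' + (P - Q') = P + P by rewrite addrACA subrr addr0.
have -> : P + Q' - (P - Q') = Q' + Q' by rewrite opprB addrC addrA subrK.
have -> : R + S' - (S' - R) = R + R by rewrite opprB addrACA subrr addr0.
have -> : R + S' + (S' - R) = S' + S' by rewrite addrC addrA subrK.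
by rewrite !half.
Qed.

Lemma unitary_block_product (C : numClosedFieldType) (n : nat)
    (A B D Z : 'M[C]_n) :
  A \is unitarymx -> B \is unitarymx -> D \is unitarymx -> Z \is unitarymx ->
  2^-1 *: (block_mx A 0 0 B
           *m block_mx (1%:M + Z) (1%:M - Z) (1%:M - Z) (1%:M + Z)
           *m block_mx 1%:M 0 0 D) \is unitarymx.
Proof.
(* Moving [2^-1] onto the middle factor makes all three factors unitary. *)
move=> uA uB uD uZ; rewrite scalemxAl scalemxAr.
have u1 : 1%:M \is @unitarymx C n n by apply/unitarymxP; rewrite trmxC1 mulmx1.
by rewrite !mul_unitarymx ?unitarymx_block_half// unitarymx_block_diag.
Qed.

Theorem theorem8p1 (R : realType) (n : nat) :
  U R (n + n) =
  [set M : 'M[R[i]]_(n + n) | exists A B C Z : 'M[R[i]]_n,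
    [/\ U R n A, U R n B, U R n C, U R n Z &
        M = 2^-1 *: (block_mx A 0 0 B
                     *m block_mx (1%:M + Z) (1%:M - Z) (1%:M - Z) (1%:M + Z)
                     *m block_mx 1%:M 0 0 C)]].
Proof.
apply/seteqP; split=> [M uM|M [A [B [D [Z [uA uB uD uZ ->]]]]]].
  exact: unitary_block_factor uM.
exact: unitary_block_product uA uB uD uZ.
Qed.
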